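(* Let $n\geq 2$ be an integer and let $\mathcal{S}_n=\mathcal{R}(K_{1,n})$ be the rotation graph of the star $K_{1,n}$ with $n$ leaves. Then for each $\epsilon\in\left\{\frac{1-\sqrt5}{2},\frac{1+\sqrt5}{2}\right\}$, the number $-(n-2)-\epsilon$ is an eigenvalue of the adjacency matrix of $\mathcal{S}_n$.
   Context: Graphs are finite, simple and undirected. A search tree $T$ on a connected graph $G$ is a rooted tree with vertex set $V(G)$, defined recursively: the root of $T$ is a chosen vertex $r\in V(G)$, and the children of $r$ are the roots of search trees on each of the connected components of $G-r$. Let $T$ be a search tree on $G$ and let $v$ be a child of $u$ in $T$. The $uv$-rotation transforms $T$ into the search tree $T'$ on $G$ such that: (i) $u$ is a child of $v$ in $T'$; if $u$ is the root of $T$ then $v$ is the root of $T'$, otherwise, if $p$ is the parent of $u$ in $T$, then $p$ is the parent of $v$ in $T'$; (ii) every subtree of $u$ in $T$ other than the one rooted at $v$ remains a subtree of $u$ in $T'$; (iii) each subtree $S$ of $v$ in $T$ becomes a subtree of $u$ in $T'$ if $u$ is adjacent in $G$ to some vertex of $S$, and otherwise remains a subtree of $v$. All other parent-child relations are unchanged. The rotation graph $\mathcal{R}(G)$ is the undirected graph whose vertices are the search trees on $G$, two search trees being adjacent if one is obtained from the other by a single rotation. *)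

(* Defs.v *)
From mathcomp Require Import all_boot all_order all_algebra.

Set Implicit Arguments.
Unset Strict Implicit.
Unset Printing Implicit Defensive.

Import Order.TTheory GRing.Theory Num.Theory.

Record sgraph := SGraph {
  vertex :> finType;
  edge : rel vertex;
  edge_sym : symmetric edge;
  edge_irrefl : irreflexive edge }.

Definition induced_edge (G : sgraph) (A : {set G}) : rel G :=
  [rel x y | [&& x \in A, y \in A & edge x y]].

(* The vertex sets of the connected components of the induced subgraph G[A]. *)
Definition components (G : sgraph) (A : {set G}) : {set {set G}} :=
  equivalence_partition (connect (induced_edge A)) A.

Section SearchTree.

Variable G : sgraph.

(* A rooted tree on V(G) is encoded by its parent map p: p v = Some u when u is
   the parent of v, and p v = None when v is the root. *)
Implicit Types p : {ffun G -> option G}.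

(* The natural number k is only recursion fuel; see search_tree_onE below. *)
Fixpoint search_tree_rec (k : nat) p (A : {set G}) (r : G) : bool :=
  if k is k'.+1 then
    (r \in A) &&
    [forall C in components (A :\ r),
      [exists c, (p c == Some r) && search_tree_rec k' p C c]]
  else false.

(* p describes, below r, a search tree with root r on the subgraph G[A]
   (which is meant to be connected). *)
Definition search_tree_on p (A : {set G}) (r : G) : bool :=
  search_tree_rec #|A| p A r.

Definition is_search_tree p : bool :=
  [exists r, (p r == None) && search_tree_on p [set: G] r].

Definition search_tree : finType := {p : {ffun G -> option G} | is_search_tree p}.

(* The vertex set of the subtree rooted at w: all descendants of w, w included. *)
Definition subtree p (w : G) : {set G} :=
  [set x | connect [rel y z | p y == Some z] x w].

(* The parent map after the uv-rotation; meaningful when v is a child of u. *)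
Definition rotate p (u v : G) : {ffun G -> option G} :=
  [ffun w =>
    if w == v then p u
    else if w == u then Some v
    else if (p w == Some v) && [exists x in subtree p w, edge u x] then Some u
    else p w].

Definition rotates_to (T T' : search_tree) : bool :=
  [exists u, exists v, (val T v == Some u) && (val T' == rotate (val T) u v)].

Definition rotation_edge : rel search_tree :=
  [rel T T' | rotates_to T T' || rotates_to T' T].

Lemma components_sub (A C : {set G}) : C \in components A -> C \subset A.
Proof.
case/imsetP=> x _ ->; apply/subsetP=> y; by rewrite inE => /andP[].
Qed.

Lemma components_cover (A : {set G}) (x : G) :
  x \in A -> exists2 C, C \in components A & x \in C.
Proof.
move=> xA; exists [set y in A | connect (induced_edge A) x y].
  by apply/imsetP; exists x.
by rewrite inE xA connect0.
Qed.

Lemma search_tree_rec_fuel (k l : nat) p (A : {set G}) (r : G) :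
  #|A| <= k -> #|A| <= l -> search_tree_rec k p A r = search_tree_rec l p A r.
Proof.
elim: k l A r => [|k IHk] [|l] A r /= Ak Al //.
- by move: Ak; rewrite leqn0 cards_eq0 => /eqP->; rewrite inE.
- by move: Al; rewrite leqn0 cards_eq0 => /eqP->; rewrite inE.
case rA: (r \in A) => //=; apply: eq_forallb => C.
case CA: (C \in _) => //=; apply: eq_existsb => c; congr (_ && _).
have := subset_leq_card (components_sub CA).
rewrite (cardsD1 r A) rA !add1n !ltnS in Ak Al => hC.
by apply: IHk; apply: leq_trans hC _.
Qed.

Lemma search_tree_onE p (A : {set G}) (r : G) :
  search_tree_on p A r =
  (r \in A) &&
  [forall C in components (A :\ r),
    [exists c, (p c == Some r) && search_tree_on p C c]].
Proof.
rewrite /search_tree_on (@search_tree_rec_fuel #|A| #|A|.+1) //=.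
case rA: (r \in A) => //=; apply: eq_forallb => C.
case CA: (C \in _) => //=; apply: eq_existsb => c; congr (_ && _).
apply: search_tree_rec_fuel => //.
by apply: leq_trans (subset_leq_card (components_sub CA)) (subset_leq_card (subsetDl _ _)).
Qed.

Lemma search_tree_parent_neq p (v : G) : is_search_tree p -> p v != Some v.
Proof.
case/existsP=> r /andP[/eqP pr]; rewrite /search_tree_on.
have [->|vr] := eqVneq v r; first by rewrite pr.
suff st_neq k (A : {set G}) s :
    v != s -> v \in A -> search_tree_rec k p A s -> p v != Some v.
  exact: st_neq.
elim: k A s => [|k IHk] A s // vs vA.
case/andP=> _ /forall_inP stA.
have [|C CA vC] := @components_cover (A :\ s) v; first by rewrite !inE vs.
have /existsP[c /andP[/eqP pc stC]] := stA _ CA.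
have [vc|vc] := eqVneq v c; last exact: (IHk C c).
by rewrite vc pc -vc; apply: contra vs => /eqP[->].
Qed.

Lemma rotation_edge_sym : symmetric rotation_edge.
Proof. by move=> T T'; exact: orbC. Qed.

Lemma rotation_edge_irrefl : irreflexive rotation_edge.
Proof.
move=> T; rewrite /rotation_edge [LHS]orbb; apply/existsP=> -[u /existsP[v /andP[/eqP pv]]].
move/eqP/ffunP/(_ v); rewrite ffunE eqxx pv => pu.
by have := search_tree_parent_neq u (valP T); rewrite -pu eqxx.
Qed.

Definition rotation_graph : sgraph :=
  SGraph rotation_edge_sym rotation_edge_irrefl.

End SearchTree.

(* The star K_{1,n}: None is the centre and the Some i are the n leaves. *)
Definition star_edge (n : nat) : rel (option 'I_n) :=
  [rel x y | (x == None) != (y == None)].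

Lemma star_edge_sym n : symmetric (@star_edge n).
Proof. by case=> [?|] [?|]. Qed.

Lemma star_edge_irrefl n : irreflexive (@star_edge n).
Proof. by case. Qed.

Definition star (n : nat) : sgraph :=
  SGraph (@star_edge_sym n) (@star_edge_irrefl n).

Definition adjacency_mx (R : nzRingType) (G : sgraph) : 'M[R]_#|G| :=
  (\matrix_(i, j) (edge (enum_val i) (enum_val j))%:R)%R.

(* Main.v *)
Require Import Defs.
From mathcomp Require Import all_boot all_order all_algebra.
From mathcomp Require Import ring.
Import Order.TTheory GRing.Theory Num.Theory.
Local Open Scope ring_scope.

Set Implicit Arguments.
Unset Strict Implicit.

(** A search tree on the star with n leaves removes some leaves one after the
other and then the centre, below which all remaining leaves hang.  So search
trees are the repetition-free sequences s of leaves
(search_tree_chain, chain_search_tree, chain_parent_inj), and a rotation either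
exchanges two consecutive entries of s, or deletes the last entry, or appends a
missing leaf (rotates_toP).

The eigenvector is supported on the sequences that miss at most one leaf, which
are the same thing as permutations of the leaves, each one occurring twice: a
sequence s that misses one leaf stands for the permutation that continues s by
this leaf.  Give s the sign of its permutation, multiplied by 1 if no leaf is
missing and by 1 - eps if one is missing (signed_weight).  An exchange of neighbouring
entries changes the sign, so the exchanges contribute - (n - 1) times the
entry at length n, and - (n - 2) times at length n - 1.  The two copies of a
permutation are adjacent.  A sequence that misses two leaves i and j has two
neighbours in the support; their permutations differ by the exchange of i and
j, so they cancel.  What remains is the eigenvalue problem of the matrix
- (n - 2) + [[-1, 1], [1, 0]], and (1, 1 - eps) is an eigenvector of
[[-1, 1], [1, 0]] for - eps exactly when eps ^ 2 = eps + 1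
(sum_neighbors). *)

(** * Parent maps of paths *)

Section ParentAlong.
Variable A : eqType.
Implicit Types (d : option A) (c : seq A) (w x y : A).

(** Parents along the path c whose first vertex has parent d. Every vertex
outside c becomes a child of the last vertex of c; for the star, this is what
the leaves that remain after the removal of the centre do. *)
Fixpoint parent_along d c w : option A :=
  if c is x :: c' then if w == x then d else parent_along (Some x) c' w else d.

Lemma parent_along_mem d c w : parent_along d c w \in d :: map Some c.
Proof.
elim: c d => [|x c IHc] d /=; first by rewrite mem_head.
by case: eqP => _; rewrite inE ?eqxx // IHc orbT.
Qed.

Lemma parent_along_neq d c w y :
  d != Some y -> y \notin c -> parent_along d c w != Some y.
Proof.
move=> dy yc; apply: contraTneq (parent_along_mem d c w) => ->.
by rewrite inE eq_sym negb_or dy mem_map // => ? ? [].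
Qed.

Lemma parent_along_notin d c w :
  w \notin c -> parent_along d c w = last d (map Some c).
Proof.
elim: c d => //= x c IHc d; rewrite inE negb_or => /andP[/negPf-> wc].
exact: IHc.
Qed.

Lemma parent_along_cat d c1 c2 w :
  parent_along d (c1 ++ c2) w =
  if w \in c1 then parent_along d c1 w
  else parent_along (last d (map Some c1)) c2 w.
Proof.
elim: c1 d => //= x c1 IHc d; rewrite inE.
by case: eqP => //= _; rewrite IHc.
Qed.

End ParentAlong.

Arguments parent_along {A}.

(** * Search trees on the star *)

Section Star.
Variable n : nat.
Local Notation V := (vertex (star n)).
Local Notation comps := (@components (star n)).
Implicit Types (s t : seq 'I_n) (B C : {set V}) (p : {ffun V -> option V}).
Implicit Types T : search_tree (star n).

Lemma star_components_center B : None \in B -> comps B = [set B].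
Proof.
move=> NB; have conn x y : x \in B -> y \in B -> connect (induced_edge B) x y.
  have aux z : z \in B ->
      connect (induced_edge B) z None && connect (induced_edge B) None z.
    case: z => [i|] zB; last by rewrite connect0.
    by apply/andP; split; apply: connect1; apply/and3P.
  move=> /aux/andP[xN _] /aux/andP[_ Ny]; exact: connect_trans xN Ny.
apply/setP=> C; rewrite inE; apply/imsetP/eqP=> [[x xB ->]|->].
  by apply/setP=> y; rewrite inE; case yB: (y \in B) => //=; rewrite conn.
exists None => //; apply/setP=> y; rewrite inE.
by case yB: (y \in B) => //=; rewrite conn.
Qed.

Lemma star_components_leaves B C :
  None \notin B -> C \in comps B -> exists2 x, x \in B & C = [set x].
Proof.
move=> NB /imsetP[x xB ->]; exists x => //; apply/setP=> y; rewrite !inE.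
apply/andP/eqP=> [[yB /connectP[q]]|->]; last by rewrite connect0.
case: q => [|z q] //= /andP[/and3P[_ zB xz] _] _.
case: x z xB zB xz => [i|] [j|] //; by rewrite (negPf NB).
Qed.

(** The centre None ends the path; the leaves not in s hang below it. *)
Definition chain s : seq V := rcons (map Some s) None.

Lemma mem_chain s (w : V) : (w \in chain s) = (w \in None :: map Some s).
Proof. by rewrite mem_rcons. Qed.

Lemma mem_map_Some s (i : 'I_n) : ((Some i : V) \in map Some s) = (i \in s).
Proof. by rewrite mem_map // => ? ? []. Qed.

Lemma None_map_Some s : (None : V) \notin map Some s.
Proof. by apply/mapP=> -[]. Qed.

Lemma Some_chain s (i : 'I_n) : ((Some i : V) \in chain s) = (i \in s).
Proof. by rewrite mem_chain inE /= mem_map_Some. Qed.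

Lemma uniq_chain s : uniq (chain s) = uniq s.
Proof. by rewrite rcons_uniq None_map_Some map_inj_uniq // => ? ? []. Qed.

Lemma parent_along_head d s : parent_along d (chain s) (head None (chain s)) = d.
Proof. by case: s => //= i s; rewrite eqxx. Qed.

(** As long as the centre is present the remaining graph is connected, so each
removed leaf has a single child; once the centre is removed, the components are
single vertices. *)
Lemma search_tree_chain k p B (r : V) :
  None \in B -> search_tree_rec k p B r ->
  exists s, [/\ uniq s, {subset map Some s <= B}, r = head None (chain s)
    & {in B, forall w, p w = parent_along (p r) (chain s) w}].
Proof.
elim: k B r => //= k IHk B r NB /andP[rB /forall_inP recB].
case: r rB recB => [i|] rB recB.
  have NB' : None \in B :\ Some i by rewrite !inE.
  have CB : B :\ Some i \in comps (B :\ Some i).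
    by rewrite star_components_center // inE.
  have /existsP[c /andP[/eqP pc /(IHk _ _ NB')[s [us sB _ ps]]]] := recB _ CB.
  exists (i :: s); split=> //=.
  - rewrite us andbT -mem_map_Some; apply/negP=> /sB; by rewrite !inE eqxx.
  - by move=> w; rewrite inE => /predU1P[->//|/sB]; rewrite inE => /andP[].
  - move=> w wB; case: eqP => [->//|/eqP wi].
    by rewrite -pc ps // !inE wi.
exists [::]; split=> //= w wB; case: eqP => [->//|/eqP wN].
have [C CB wC] : exists2 C, C \in comps (B :\ None) & w \in C.
  by apply: components_cover; rewrite !inE wN.
have /existsP[c /andP[/eqP pc]] := recB _ CB.
have [|x xB defC] := star_components_leaves _ CB; first by rewrite !inE.
move: wC; rewrite defC inE => /eqP->.
by case: k {IHk recB} => //= k /andP[]; rewrite inE => /eqP<-.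
Qed.

Lemma chain_search_tree s p B d :
  uniq s -> None \in B -> {subset map Some s <= B} ->
  {in B, forall w, p w = parent_along d (chain s) w} ->
  search_tree_on p B (head None (chain s)).
Proof.
elim: s B d => [|i s IHs] B d us NB sB pB; rewrite search_tree_onE.
  rewrite NB; apply/forall_inP=> C CB.
  have [|x] := star_components_leaves _ CB; first by rewrite !inE.
  rewrite !inE => /andP[xN xB] ->; apply/existsP; exists x.
  rewrite pB //= (negPf xN) eqxx search_tree_onE inE eqxx.
  by apply/forall_inP=> D /imsetP[y]; rewrite !inE; case: eqP.
have iB : (Some i : V) \in B by apply: sB; rewrite mem_head.
case/andP: us => is_s us; rewrite /= iB; apply/forall_inP=> C.
rewrite star_components_center ?inE // => /eqP->.
have sub : {subset map Some s <= B :\ Some i}.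
  move=> w ws; rewrite !inE sB ?inE ?ws ?orbT // andbT.
  by apply: contraNneq is_s => wi; rewrite -mem_map_Some -wi.
apply/existsP; exists (head None (chain s)).
have hB : head None (chain s) \in B :\ Some i.
  case: (s) sub => [|j s'] sub /=; rewrite ?inE //.
  by have := sub (Some j); rewrite !inE eqxx; apply.
rewrite (IHs _ (Some (Some i))) ?inE //.
  rewrite andbT pB; last by case/setD1P: hB.
  rewrite /=; case/setD1P: hB => /negPf-> _.
  by rewrite parent_along_head.
by move=> w /setD1P[wi wB]; rewrite pB //= (negPf wi).
Qed.

Definition chain_tree s : {ffun V -> option V} :=
  [ffun w => parent_along None (chain s) w].

Lemma chain_tree_search s : uniq s -> is_search_tree (chain_tree s).
Proof.
move=> us; apply/existsP; exists (head None (chain s)).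
rewrite (@chain_search_tree s _ _ None) ?inE // => [|w _|w _].
- by rewrite ffunE andbT parent_along_head.
- by rewrite inE.
- by rewrite ffunE.
Qed.

Lemma search_treeP T : exists s, uniq s && (val T == chain_tree s).
Proof.
have /existsP[r /andP[/eqP pr /search_tree_chain[]]] := valP T.
  by rewrite inE.
move=> s [us _ _ ps]; exists s; rewrite us; apply/eqP/ffunP=> w.
by rewrite ffunE ps ?inE ?pr.
Qed.

(** The first vertex is the only vertex of the path whose parent is d, because
all other parents are vertices of the path; the rest follows by induction. *)
Lemma chain_parent_inj d s t :
  uniq s -> uniq t -> d \notin map Some (chain t) ->
  {in chain s, parent_along d (chain s) =1 parent_along d (chain t)} -> s = t.
Proof.
elim: s d t => [|i s IHs] d [|j t] //=.
- move=> _ _ dt /(_ None); rewrite mem_head => /(_ isT) /= dE.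
  have := parent_along_mem (Some (Some j : V)) (chain t) None.
  by rewrite -dE (negPf dt).
- move=> _ _; rewrite inE => /eqP dN /(_ (Some i)).
  by rewrite mem_head /= eqxx => /(_ isT).
move=> /andP[i_s us] /andP[j_t ut] dt E.
have ij : i = j.
  apply: contraNeq dt => ij; have := E (Some i); rewrite mem_head /= eqxx.
  move=> /(_ isT); case: eqP => [[/eqP]|_ ->]; first by rewrite (negPf ij).
  exact: (parent_along_mem (Some (Some j : V))).
rewrite -{}ij in dt j_t E *; congr (_ :: _); apply: (IHs (Some (Some i))) => //.
  by rewrite mem_map ?Some_chain // => ? ? [].
move=> w ws; have := E w; rewrite /= inE ws orbT => /(_ isT).
case: eqP => // wi; by rewrite wi Some_chain (negPf i_s) in ws.
Qed.

Lemma chain_tree_inj s t :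
  uniq s -> uniq t -> chain_tree s = chain_tree t -> s = t.
Proof.
move=> us ut /ffunP E; apply: (chain_parent_inj us ut (d := None)).
  by apply/mapP=> -[].
by move=> w _; have := E w; rewrite !ffunE.
Qed.

Definition tree_seq T : seq 'I_n := xchoose (search_treeP T).

Lemma tree_seq_uniq T : uniq (tree_seq T).
Proof. by case/andP: (xchooseP (search_treeP T)). Qed.

Lemma tree_seqE T : val T = chain_tree (tree_seq T).
Proof. by case/andP: (xchooseP (search_treeP T)) => _ /eqP. Qed.

Lemma tree_seqP T s : uniq s -> val T = chain_tree s <-> tree_seq T = s.
Proof.
move=> us; rewrite tree_seqE; split=> [|->//].
by apply: chain_tree_inj us; apply: tree_seq_uniq.
Qed.

(** * Rotations as moves on sequences *)

Lemma chain_cat s t : chain (s ++ t) = map Some s ++ chain t.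
Proof. by rewrite /chain map_cat rcons_cat. Qed.

Lemma parent_along_connect p d (z : V) c :
  uniq (z :: c) -> {in z :: c, p =1 parent_along d (z :: c)} ->
  {in z :: c, forall w, connect [rel x y | p x == Some y] (last z c) w}.
Proof.
elim: c d z => [|y c IHc] d z; first by move=> _ _ w; rewrite inE => /eqP->.
move=> /= /andP[z_yc uyc] pE.
have IH := IHc (Some z) y uyc.
have pz : {in y :: c, p =1 parent_along (Some z) (y :: c)}.
  move=> w wyc; rewrite pE; last by rewrite in_cons wyc orbT.
  by case: (w =P z) => // wz; rewrite -wz wyc in z_yc.
move=> w; rewrite in_cons => /predU1P[->|wyc]; last exact: (IH pz w wyc).
apply: (connect_trans (IH pz y (mem_head _ _))); apply: connect1 => /=.
by rewrite pz ?mem_head //= eqxx.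
Qed.

(** The centre lies below every vertex of the path; this decides which subtrees
move in a rotation, since each leaf is adjacent to the centre only. *)
Lemma chain_center_subtree s (w : V) :
  uniq s -> w \in chain s -> None \in subtree (chain_tree s) w.
Proof.
rewrite -uniq_chain inE => us ws.
have := @parent_along_connect (chain_tree s) None (head None (chain s))
          (behead (chain s)).
have -> : head None (chain s) :: behead (chain s) = chain s by case: (s).
have -> : last (head None (chain s)) (behead (chain s)) = None.
  by case: (s) => //= x t; rewrite /chain last_rcons.
by apply => // x _; rewrite ffunE.
Qed.

(** The subtree below y contains the centre, which is adjacent to x, so it is
attached to x by the rotation. *)
Lemma rotate_swap s1 s2 (x y : 'I_n) :
  uniq (s1 ++ x :: y :: s2) ->
  rotate (chain_tree (s1 ++ x :: y :: s2)) (Some x) (Some y) =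
  chain_tree (s1 ++ y :: x :: s2).
Proof.
move=> us; have := us; rewrite cat_uniq /= !inE !negb_or.
case/and4P=> _ /and3P[xs1 ys1 _] /andP[xy xs2] /andP[ys2 us2].
have SS (i j : 'I_n) : ((Some i : V) == Some j) = (i == j) by [].
apply/ffunP=> w; rewrite [LHS]ffunE; case: eqP => [->|/eqP wy].
  rewrite !ffunE !chain_cat !parent_along_cat !mem_map_Some.
  by rewrite (negPf xs1) (negPf ys1) /= !eqxx.
case: eqP => [->|/eqP wx].
  rewrite !ffunE !chain_cat !parent_along_cat !mem_map_Some.
  by rewrite (negPf xs1) /= SS (negPf xy) eqxx.
(* The vertex that follows y is the only one that changes its parent besides
   x and y. *)
have [wc|wc] := eqVneq w (head None (chain s2)).
  have ws1 : w \notin map Some s1.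
    rewrite wc; case: (s2) us => [|z t] /=; first by rewrite None_map_Some.
    rewrite mem_map_Some cat_uniq /= => /and3P[_ + _].
    by rewrite !negb_or => /and4P[].
  have -> : chain_tree (s1 ++ x :: y :: s2) w = Some (Some y).
    rewrite ffunE chain_cat parent_along_cat (negPf ws1) /=.
    by rewrite (negPf wx) (negPf wy) wc; apply: parent_along_head.
  have -> : chain_tree (s1 ++ y :: x :: s2) w = Some (Some x).
    rewrite ffunE chain_cat parent_along_cat (negPf ws1) /=.
    by rewrite (negPf wx) (negPf wy) wc; apply: parent_along_head.
  rewrite eqxx /= ifT //; apply/existsP; exists None.
  rewrite chain_center_subtree //= wc chain_cat mem_cat; apply/orP; right.
  by case: (s2) => [|z t]; rewrite /= !inE eqxx ?orbT.
have -> : chain_tree (s1 ++ y :: x :: s2) w = chain_tree (s1 ++ x :: y :: s2) w.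
  rewrite !ffunE !chain_cat !parent_along_cat /=.
  rewrite (negPf wx) (negPf wy); case: ifP => // _.
  by case: (s2) wc => [|z t] /= /negPf->.
rewrite ifN // negb_and; apply/orP; left.
rewrite ffunE chain_cat parent_along_cat /= (negPf wx) (negPf wy).
case: ifP => _; first by apply: parent_along_neq; rewrite ?mem_map_Some.
case: (s2) wc ys2 => [|z t] /= /negPf->; first by [].
rewrite inE negb_or => /andP[yz yt].
apply: parent_along_neq; rewrite ?Some_chain //.
by apply: contraNneq yz => -[->].
Qed.

(** The other children of the centre are single leaves, not adjacent to x, so
they stay below the centre. *)
Lemma rotate_remove s (x : 'I_n) :
  uniq (rcons s x) ->
  rotate (chain_tree (rcons s x)) (Some x) None = chain_tree s.
Proof.
rewrite rcons_uniq -cats1 => /andP[xs us].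
apply/ffunP=> w; rewrite [LHS]ffunE; case: eqP => [->|/eqP wN].
  rewrite !ffunE chain_cat /chain -[rcons (map Some s) _]cats1.
  rewrite !parent_along_cat mem_map_Some (negPf xs) /= eqxx.
  by rewrite (negPf (None_map_Some s)).
case: eqP => [->|/eqP wx].
  by rewrite ffunE parent_along_notin ?Some_chain // /chain map_rcons last_rcons.
have E : chain_tree (s ++ [:: x]) w =
    if w \in map Some s then parent_along None (map Some s) w else Some None.
  by rewrite ffunE chain_cat parent_along_cat /= (negPf wx) (negPf wN).
have -> : chain_tree s w = chain_tree (s ++ [:: x]) w.
  rewrite E ffunE /chain -[rcons (map Some s) _]cats1 parent_along_cat /=.
  by rewrite (negPf wN).
rewrite ifN // negb_and E; case: ifP => ws.
  by rewrite parent_along_neq ?None_map_Some.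
apply/orP; right; apply/existsP=> -[[i /andP[_] //|/andP[]]]; rewrite inE.
(* The leaf w is off the path, so it is nobody's parent. *)
case/connectP=> q; case/lastP: q => [_ wE _|q z]; first by rewrite wE in wN.
rewrite last_rcons rcons_path => /andP[_ /= pz] wz _; move: pz; rewrite -{z}wz.
rewrite ffunE; apply/negP; apply: parent_along_neq => //.
by rewrite chain_cat mem_cat negb_or ws /= !inE negb_or wx wN.
Qed.

Lemma rotate_append s (x : 'I_n) :
  x \notin s ->
  rotate (chain_tree s) None (Some x) = chain_tree (rcons s x).
Proof.
move=> xs; apply/ffunP=> w; rewrite [LHS]ffunE -cats1 !ffunE chain_cat.
have pNx (z : V) : parent_along None (chain s) z != Some (Some x).
  by apply: parent_along_neq; rewrite ?Some_chain.
rewrite (negPf (pNx w)) /= /chain -cats1 !parent_along_cat.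
case: eqP => [->|/eqP wx].
  by rewrite !(negPf (None_map_Some s)) mem_map_Some (negPf xs) /= eqxx.
case: eqP => [->|/eqP wN].
  by rewrite !(negPf (None_map_Some s)).
by rewrite /= (negPf wx) (negPf wN).
Qed.

Fixpoint adjacent_swaps s :=
  if s is x :: t then
    (if t is y :: u then [:: y :: x :: u] else [::])
      ++ map (cons x) (adjacent_swaps t)
  else [::].

Definition removals s := if s is x :: t then [:: belast x t] else [::].

Definition missing s := [seq j <- enum 'I_n | j \notin s].

Definition neighbors s :=
  adjacent_swaps s ++ removals s ++ map (rcons s) (missing s).

Lemma adjacent_swapsP s t :
  reflect (exists s1 x y s2, s = s1 ++ [:: x, y & s2] /\ t = s1 ++ [:: y, x & s2])
    (t \in adjacent_swaps s).
Proof.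
apply: (iffP idP) => [|[s1 [x [y [s2 [-> ->]]]]]]; last first.
  elim: s1 => [|z s1 IHs] /=; first by rewrite mem_head.
  by rewrite mem_cat map_f ?orbT.
elim: s t => //= x [|y s] // IHs t; rewrite inE => /predU1P[->|].
  by exists [::], x, y, s.
case/mapP=> u /IHs[s1 [a [b [s2 [-> ->]]]]] ->.
by exists (x :: s1), a, b, s2.
Qed.

Lemma removalsP s t : reflect (exists x, s = rcons t x) (t \in removals s).
Proof.
case/lastP: s => [|s x]; first by constructor=> -[x]; case: t.
have -> : removals (rcons s x) = [:: s].
  by case: s => //= y s; rewrite belast_rcons.
rewrite inE; apply: (iffP eqP) => [->|[y /rcons_inj[-> //]]]; by exists x.
Qed.

Lemma mem_missing s i : (i \in missing s) = (i \notin s).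
Proof. by rewrite mem_filter mem_enum andbT. Qed.

Variant neighbor_spec s t : Prop :=
| NeighborSwap s1 x y s2 of
    s = s1 ++ [:: x, y & s2] & t = s1 ++ [:: y, x & s2]
| NeighborRemove x of s = rcons t x
| NeighborAppend x of x \notin s & t = rcons s x.

Lemma neighborsP s t : reflect (neighbor_spec s t) (t \in neighbors s).
Proof.
rewrite /neighbors !mem_cat; apply: (iffP or3P).
  case=> [/adjacent_swapsP[s1 [x [y [s2 [sE tE]]]]]|/removalsP[x sE]|].
  - exact: NeighborSwap sE tE.
  - exact: NeighborRemove sE.
  by case/mapP=> x; rewrite mem_missing => xs tE; apply: NeighborAppend xs tE.
case=> [s1 x y s2 sE tE|x sE|x xs ->].
- by constructor 1; apply/adjacent_swapsP; exists s1, x, y, s2.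
- by constructor 2; apply/removalsP; exists x.
- by constructor 3; rewrite map_f ?mem_missing.
Qed.

Lemma perm_swap s1 s2 (x y : 'I_n) :
  perm_eq (s1 ++ [:: x, y & s2]) (s1 ++ [:: y, x & s2]).
Proof.
rewrite perm_cat2l -[_ :: _]/([:: x; y] ++ s2) -[[:: y, x & s2]]/([:: y; x] ++ s2).
by rewrite perm_cat2r (perm_catC [:: x] [:: y]).
Qed.

Lemma neighbors_uniq_seq s t : uniq s -> t \in neighbors s -> uniq t.
Proof.
move=> us /neighborsP[s1 x y s2 sE ->|x sE|x xs ->].
- by rewrite -(perm_uniq (perm_swap s1 s2 x y)) -sE.
- by move: us; rewrite sE rcons_uniq => /andP[].
- by rewrite rcons_uniq xs.
Qed.

Lemma neighbors_sym s t : uniq s -> t \in neighbors s -> s \in neighbors t.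
Proof.
move=> us /neighborsP[s1 x y s2 sE tE|x sE|x xs tE]; apply/neighborsP.
- exact: NeighborSwap tE sE.
- by move: us; rewrite {1}sE rcons_uniq => /andP[xt _]; apply: NeighborAppend sE.
- exact: NeighborRemove tE.
Qed.

Lemma uniq_adjacent_swaps s : uniq s -> uniq (adjacent_swaps s).
Proof.
elim: s => //= x s IHs /andP[xs /IHs us].
have us' : uniq (map (cons x) (adjacent_swaps s)).
  by rewrite map_inj_uniq // => ? ? [].
case: s xs us' {IHs us} => //= y s; rewrite inE negb_or => /andP[xy _] ->.
by rewrite andbT; apply: contra xy => /mapP[u _ [->]].
Qed.

(** The three kinds of moves give sequences of three different lengths. *)
Lemma uniq_neighbors s : uniq s -> uniq (neighbors s).
Proof.
move=> us; have size_swap t : t \in adjacent_swaps s -> size t = size s.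
  by case/adjacent_swapsP=> [s1 [x [y [s2 [-> ->]]]]]; rewrite !size_cat.
have size_rem t : t \in removals s -> size s = (size t).+1.
  by case/removalsP=> x ->; rewrite size_rcons.
have size_app t : t \in map (rcons s) (missing s) -> size t = (size s).+1.
  by case/mapP=> x _ ->; rewrite size_rcons.
rewrite !cat_uniq uniq_adjacent_swaps //=; apply/and3P; split.
- apply/hasPn=> t; rewrite mem_cat => /orP[/size_rem|/size_app] st.
    by apply/negP=> /size_swap E; move: st; rewrite E => /n_Sn.
  by apply/negP=> /size_swap E; move: st; rewrite E => /n_Sn.
- by case: (s).
apply/andP; split.
  apply/hasPn=> t /size_app st; apply/negP=> /size_rem E.
  by move/eqP: E; rewrite st -addn2 -{1}[size s]addn0 eqn_add2l.
rewrite map_inj_uniq; first by rewrite filter_uniq ?enum_uniq.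
by move=> x y /rcons_inj[].
Qed.

(** The lower vertex v of the rotated pair decides the move: the centre gives
the removal of the last entry, an entry of the sequence gives the exchange with
the preceding entry, and any other leaf is appended. *)
Lemma rotates_toP T T' :
  rotates_to T T' = (tree_seq T' \in neighbors (tree_seq T)).
Proof.
have us := tree_seq_uniq T; have us' := tree_seq_uniq T'.
apply/idP/idP.
  case/existsP=> u /existsP[v /andP[/eqP pv /eqP]].
  rewrite tree_seqE in pv *; move: (tree_seq T) us pv => {T} s us pv E.
  suff [t ts E'] : exists2 t, t \in neighbors s
      & rotate (chain_tree s) u v = chain_tree t.
    have ut := neighbors_uniq_seq us ts.
    by move: E; rewrite E' => /(tree_seqP _ ut)->.
  have pvE := pv; rewrite ffunE in pv.
  case: v pv pvE E => [j|] pv pvE E.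
    have [js|js] := boolP (j \in s); last first.
      exists (rcons s j); first by apply/neighborsP/NeighborAppend; first exact: js.
      move: pv; rewrite parent_along_notin ?Some_chain // /chain map_rcons last_rcons.
      by case=> <-; apply: rotate_append.
    case/splitPr: js us pv {pvE E} => s1 s2.
    rewrite chain_cat parent_along_cat => us.
    have js1 : j \notin s1.
      by move: us; rewrite uniq_catC /= mem_cat negb_or => /andP[/andP[]].
    rewrite mem_map_Some (negPf js1) /= eqxx.
    case/lastP: s1 us js1 => [//|s1 x] us _.
    rewrite !map_rcons last_rcons => -[<-]; rewrite cat_rcons in us *.
    exists (s1 ++ [:: j, x & s2]); last exact: rotate_swap.
    by apply/neighborsP/NeighborSwap.
  case/lastP: s us pv {pvE E} => [|s x] us.
    by [].
  rewrite -cats1 chain_cat parent_along_cat (negPf (None_map_Some s)) /=.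
  case=> <-; exists s; last by rewrite cats1 rotate_remove.
  by apply/neighborsP; rewrite cats1; apply: NeighborRemove.
move/neighborsP=> nb; apply/existsP.
suff [u [v [pv E]]] : exists u v,
    val T v = Some u /\ rotate (val T) u v = chain_tree (tree_seq T').
  by exists u; apply/existsP; exists v; rewrite pv eqxx E tree_seqE /=.
rewrite !tree_seqE; move: (tree_seq T) (tree_seq T') us us' nb => {T T'} s t us ut.
case=> [s1 x y s2 sE tE|x sE|x xs tE].
- exists (Some x), (Some y); rewrite sE tE rotate_swap -?sE //; split=> //.
  rewrite sE cat_uniq /= !inE !negb_or in us.
  case/and4P: us => _ /and3P[xs1 ys1 _] /andP[xy _] _.
  rewrite sE ffunE chain_cat parent_along_cat mem_map_Some (negPf ys1) /=.
  by rewrite eqxx ifN // eq_sym.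
- exists (Some x), None; rewrite sE rotate_remove -?sE //; split=> //.
  rewrite sE ffunE -cats1 chain_cat parent_along_cat.
  by rewrite (negPf (None_map_Some t)).
exists None, (Some x); rewrite tE rotate_append //; split=> //.
by rewrite ffunE parent_along_notin ?Some_chain // /chain map_rcons last_rcons.
Qed.

Lemma rotation_edgeE T T' :
  rotation_edge T T' = (tree_seq T' \in neighbors (tree_seq T)).
Proof.
rewrite /rotation_edge /= !rotates_toP.
by apply/orP/idP=> [[//|/neighbors_sym->//]|->]; [exact: tree_seq_uniq|left].
Qed.

Lemma tree_seq_onto s : uniq s -> exists T, tree_seq T = s.
Proof.
by move=> us; exists (Sub (chain_tree s) (chain_tree_search us)); apply/tree_seqP.
Qed.

Lemma tree_seq_inj : injective tree_seq.
Proof. by move=> T T' E; apply: val_inj; rewrite !tree_seqE E. Qed.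

Lemma sum_rotation_edge (R : nmodType) (g : seq 'I_n -> R) T :
  \sum_(T' | rotation_edge T T') g (tree_seq T') =
  \sum_(t <- neighbors (tree_seq T)) g t.
Proof.
rewrite -big_filter -(big_map tree_seq predT g) /=; apply: perm_big.
apply: uniq_perm.
- by rewrite (map_inj_uniq tree_seq_inj) filter_uniq // index_enum_uniq.
- exact/uniq_neighbors/tree_seq_uniq.
move=> s; apply/mapP/idP=> [[T'] | sT].
  by rewrite mem_filter rotation_edgeE => /andP[? _] ->.
have [T' T's] := tree_seq_onto (neighbors_uniq_seq (tree_seq_uniq T) sT).
by exists T'; rewrite // mem_filter rotation_edgeE T's sT mem_index_enum.
Qed.

(** * The signed eigenvector *)

Section Eigenvector.
Variables (R : comNzRingType) (eps : R).

Fixpoint inversions s : nat :=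
  if s is x :: t then (count (fun y : 'I_n => y < x)%N t + inversions t)%N else 0.

(** The entries 1 and 1 - eps form an eigenvector of [[-1, 1], [1, 0]] for the
eigenvalue - eps. *)
Definition weight (m : nat) : R :=
  match m with 0 => 1 | 1 => 1 - eps | _ => 0 end.

(** For the sequences in the support, at most one leaf is missing, and
s ++ missing s is the permutation of the leaves that s stands for. *)
Definition signed_weight s : R :=
  weight (size (missing s)) * (-1) ^+ inversions (s ++ missing s).

Lemma sign_inversions_swap s1 s2 (x y : 'I_n) :
  x != y ->
  (-1) ^+ inversions (s1 ++ [:: x, y & s2]) =
  - (-1) ^+ inversions (s1 ++ [:: y, x & s2]) :> R.
Proof.
move=> xy; elim: s1 => [|z s1 IHs] /=; last first.
  by rewrite !exprD IHs mulrN (permP (perm_swap s1 s2 x y)).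
rewrite !exprD; have [yx|] := ltnP y x.
  by rewrite ltnNge (ltnW yx) /=; ring.
rewrite leq_eqVlt => /predU1P[/val_inj xE|->]; first by rewrite xE eqxx in xy.
by rewrite /=; ring.
Qed.

Lemma size_missing s : uniq s -> (size s + size (missing s))%N = n.
Proof.
move=> us; rewrite -size_cat -[RHS]size_enum_ord; apply/perm_size/uniq_perm.
- rewrite cat_uniq us filter_uniq ?enum_uniq // andbT.
  by apply/hasPn=> x; rewrite mem_missing.
- exact: enum_uniq.
- by move=> x; rewrite mem_cat mem_missing mem_enum; case: (x \in s).
Qed.

Lemma missing_rcons s x : missing (rcons s x) = [seq j <- missing s | j != x].
Proof.
rewrite /missing -filter_predI; apply: eq_filter => j /=.
by rewrite mem_rcons inE negb_or.
Qed.

Lemma size_adjacent_swaps s : size (adjacent_swaps s) = (size s).-1.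
Proof.
by elim: s => //= x s IHs; rewrite size_cat size_map IHs; case: (s).
Qed.

(** An exchange keeps the set of missing leaves and changes the sign. *)
Lemma sum_adjacent_swaps s :
  uniq s ->
  \sum_(t <- adjacent_swaps s) signed_weight t =
  - signed_weight s *+ (size s).-1.
Proof.
move=> us; rewrite big_seq (eq_bigr (fun=> - signed_weight s)) => [|t].
  by rewrite -big_seq big_const_seq iter_addr_0 count_predT size_adjacent_swaps.
case/adjacent_swapsP=> [s1 [x [y [s2 [sE ->]]]]].
rewrite /signed_weight.
have -> : missing (s1 ++ [:: y, x & s2]) = missing s.
  by apply: eq_filter => j; rewrite sE (perm_mem (perm_swap s1 s2 x y)).
have xy : y != x.
  move: us; rewrite sE cat_uniq /= !inE !negb_or eq_sym.
  by case/and4P=> _ _ /andP[].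
have -> : s ++ missing s = s1 ++ [:: x, y & s2 ++ missing s].
  by rewrite {1}sE -catA.
by rewrite -catA /= (sign_inversions_swap _ _ xy) mulrN.
Qed.

(** The four cases of the proof are the number of missing leaves: 0, 1, 2, and
at least 3. Only with 2 missing leaves is there a cancellation, between the two
sequences obtained by appending one of them. *)
Lemma sum_neighbors s :
  eps ^+ 2 = eps + 1 -> (2 <= n)%N -> uniq s ->
  \sum_(t <- neighbors s) signed_weight t =
  (- (n%:R - 2) - eps) * signed_weight s.
Proof.
move=> eps2 n_gt1 us; rewrite !big_cat /= sum_adjacent_swaps // big_map.
have n_s := size_missing us.
(* If a leaf is missing already, removing another one leaves the support. *)
have rem0 : (0 < size (missing s))%N ->
    \sum_(t <- removals s) signed_weight t = 0.
  move=> ms; rewrite big_seq big1 // => t /removalsP[x sE].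
  have xt : x \in missing t.
    by move: us; rewrite mem_missing sE rcons_uniq => /andP[].
  have ut : uniq t by move: us; rewrite sE rcons_uniq => /andP[].
  have := etrans (size_missing ut) (esym n_s); rewrite sE size_rcons addSnnS => /addnI mt.
  by rewrite /signed_weight mt -sE; case: (size _) ms => //= m _; rewrite mul0r.
case ms: (missing s) n_s rem0 => [|i [|j [|k l]]] /= n_s rem0.
- rewrite big_nil addr0.
  case/lastP: s us ms n_s rem0 => [|t x] us ms n_s _.
    by rewrite -n_s in n_gt1.
  have ut : uniq t by move: us; rewrite rcons_uniq => /andP[].
  have -> : removals (rcons t x) = [:: t].
    by case: (t) => //= y u; rewrite belast_rcons.
  have mt : missing t = [:: x].
    have := etrans (size_missing ut) (esym n_s).
    rewrite addn0 size_rcons -addn1 => /addnI.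
    case E: (missing t) => [|z [|]] // _; congr [:: _].
    have : x \in missing t by move: us; rewrite mem_missing rcons_uniq => /andP[].
    by rewrite E inE => /eqP.
  have nR : n%:R = (size t)%:R + 1 :> R by rewrite -{1}n_s addn0 size_rcons -natr1.
  rewrite big_seq1 /signed_weight ms mt /= !cats0 !cats1 size_rcons /= nR.
  by rewrite -mulr_natr; ring.
- rewrite rem0 // big_seq1 add0r /signed_weight missing_rcons ms /= eqxx /=.
  have s_gt0 : (0 < size s)%N by rewrite -n_s addn1 in n_gt1.
  have nR : n%:R = (size s).-1%:R + 2 :> R.
    by rewrite -{1}n_s addn1 -{1}(prednK s_gt0) -addn2 natrD.
  rewrite !cats0 !cats1 nR -[_ *+ (size s).-1]mulr_natr; set e := _ ^+ _.
  have -> : (- ((size s).-1%:R + 2 - 2) - eps) * ((1 - eps) * e) =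
    - ((1 - eps) * e) * (size s).-1%:R - eps * e + eps ^+ 2 * e by ring.
  by rewrite eps2; ring.
- rewrite rem0 // {1 3}/signed_weight ms /= mul0r mulr0 oppr0 mul0rn !add0r.
  have ij : i != j.
    have : uniq (missing s) by rewrite filter_uniq ?enum_uniq.
    by rewrite ms /= inE andbT.
  rewrite unlock /= /signed_weight !missing_rcons ms /= !eqxx /= ij eq_sym ij /=.
  by rewrite !cat_rcons (sign_inversions_swap _ _ ij); ring.
rewrite rem0 // {1 3}/signed_weight ms /= mul0r mulr0 oppr0 mul0rn !add0r.
rewrite -ms big1_seq // => x /andP[_ xs].
have uxs : uniq (rcons s x) by rewrite rcons_uniq -mem_missing xs.
have := etrans (size_missing uxs) (esym n_s); rewrite size_rcons addSnnS => /addnI[m_x].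
by rewrite /signed_weight m_x mul0r.
Qed.

End Eigenvector.

End Star.

(** * The eigenvalue *)

Lemma golden_ratio_eq (R : rcfType) (eps : R) :
  eps = (1 - Num.sqrt 5) / 2 \/ eps = (1 + Num.sqrt 5) / 2 ->
  eps ^+ 2 = eps + 1.
Proof.
have s5 : Num.sqrt 5 ^+ 2 = 5 :> R by rewrite sqr_sqrtr ?ler0n.
case=> ->.
  have -> : ((1 - Num.sqrt 5) / 2) ^+ 2 =
      (1 - 2 * Num.sqrt 5 + Num.sqrt 5 ^+ 2) / 4 :> R by field.
  by rewrite s5; field.
have -> : ((1 + Num.sqrt 5) / 2) ^+ 2 =
    (1 + 2 * Num.sqrt 5 + Num.sqrt 5 ^+ 2) / 4 :> R by field.
by rewrite s5; field.
Qed.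

Lemma adjacency_eigenvalue (F : fieldType) (G : sgraph) (a : F) (f : G -> F) :
  (exists x, f x != 0) ->
  (forall x, \sum_(y | edge x y) f y = a * f x) ->
  eigenvalue (adjacency_mx F G) a.
Proof.
case=> x fx fE; apply/eigenvalueP; exists (\row_i f (enum_val i)).
  apply/rowP=> j; rewrite !mxE -fE [RHS]big_mkcond [RHS]big_enum_val.
  apply: eq_bigr => i _; rewrite !mxE edge_sym.
  by case: ifP; rewrite ?mulr1 ?mulr0.
by apply: contraNneq fx => /rowP/(_ (enum_rank x)); rewrite !mxE enum_rankK => ->.
Qed.

Theorem mainTheorem10 (R : rcfType) (n : nat) (hn : (2 <= n)%N) (eps : R)
  (heps : eps = (1 - Num.sqrt 5) / 2 \/ eps = (1 + Num.sqrt 5) / 2) :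
  eigenvalue (adjacency_mx R (rotation_graph (star n))) (- (n%:R - 2) - eps).
Proof.
apply: (@adjacency_eigenvalue R (rotation_graph (star n)) _
          (fun T : search_tree (star n) => signed_weight eps (tree_seq T))).
  have [T TE] := tree_seq_onto (enum_uniq 'I_n).
  exists T; rewrite TE /signed_weight.
  have -> : missing (enum 'I_n) = [::].
    apply/eqP; rewrite -[_ == _]negbK -has_filter.
    by apply/hasPn=> j; rewrite mem_enum.
  by rewrite mul1r signr_eq0.
move=> T; rewrite [LHS](sum_rotation_edge (signed_weight eps)).
by apply: sum_neighbors (golden_ratio_eq heps) hn (tree_seq_uniq T).
Qed.
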